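(* Let $h\in\mathbb{R}[x,y]$ be a harmonic polynomial of degree $n>1$, and let $g(z)=\sum_{j=0}^{n-1}a_jz^j$ (with $a_{n-1}\neq0$) be the complex polynomial associated with $h$. Suppose that the curve $h(x,y)=0$ is invariant under a nontrivial rotation $\rho_{\mathbf{p},\varphi}$ with center $\mathbf{p}\in\mathbb{R}^2$ and angle $\varphi\not\equiv 0 \pmod{2\pi}$. Then, identifying $\mathbf{p}$ with a complex number, $$\mathbf{p}=-\frac{a_{n-2}}{(n-1)a_{n-1}}.$$
   Context: A polynomial $h\in\mathbb{R}[x,y]$ is harmonic if $\partial_x^2h+\partial_y^2h=0$. The plane $\mathbb{R}^2$ is identified with $\mathbb{C}$ via $(x,y)\leftrightarrow z=x+\mathrm{i}y$. For a nonconstant harmonic $h$, the function $\partial_x h-\mathrm{i}\,\partial_y h$ is a polynomial in $z=x+\mathrm{i}y$ alone; the univariate complex polynomial $g$ with $g(x+\mathrm{i}y)=\partial_xh(x,y)-\mathrm{i}\,\partial_yh(x,y)$ is called the polynomial associated with $h$. If $\deg h=n$ then $\deg g=n-1$. The curve $h=0$ is considered as the zero set of $h$ in $\mathbb{C}^2$, on which isometries of $\mathbb{R}^2$ act by the same formulas. *)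

(* Defs.v *)
From HB Require Import structures.
From mathcomp Require Export all_boot all_order all_algebra.
From mathcomp Require Export classical_sets reals trigo.
From mathcomp Require Export complex.
From mathcomp Require Export mpoly.

Set Implicit Arguments.
Unset Strict Implicit.
Unset Printing Implicit Defensive.

Import Order.TTheory GRing.Theory Num.Theory.

Local Open Scope classical_set_scope.
Local Open Scope ring_scope.
Local Open Scope complex_scope.

(* The variables x and y are 'X_ord0 and 'X_ord_max. *)
Definition dx (R : comNzRingType) (h : {mpoly R[2]}) : {mpoly R[2]} :=
  mderiv ord0 h.

Definition dy (R : comNzRingType) (h : {mpoly R[2]}) : {mpoly R[2]} :=
  mderiv ord_max h.

Definition eval2 (R : comNzRingType) (h : {mpoly R[2]}) (x y : R) : R :=
  h.@[tnth [tuple x; y]].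

Definition harmonic (R : realType) (h : {mpoly R[2]}) : Prop :=
  dx (dx h) + dy (dy h) = 0.

(* The quantifiers range over real points only; this already determines g. *)
Definition associated (R : realType) (h : {mpoly R[2]}) (g : {poly R[i]})
    : Prop :=
  forall x y : R, g.[x +i* y] = eval2 (dx h) x y -i* eval2 (dy h) x y.

Definition curve (R : realType) (h : {mpoly R[2]}) : set (R[i] * R[i]) :=
  [set v | eval2 (map_mpoly (real_complex R) h) v.1 v.2 = 0].

(* The rotation of the real plane with center p and angle phi, acting on C^2
   by the same formulas. *)
Definition rotation (R : realType) (p : R * R) (phi : R) (v : R[i] * R[i])
    : R[i] * R[i] :=
  (p.1%:C + (cos phi)%:C * (v.1 - p.1%:C) - (sin phi)%:C * (v.2 - p.2%:C),
   p.2%:C + (sin phi)%:C * (v.1 - p.1%:C) + (cos phi)%:C * (v.2 - p.2%:C)).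

Definition invariant_under (T : Type) (f : T -> T) (V : set T) : Prop :=
  f @` V = V.

(* Main.v *)
(* With g the polynomial associated with h, let F and G be primitives of g and
   of its coefficientwise conjugate.  In the isotropic coordinates u = x + iy,
   v = x - iy, the complexification satisfies 2 h = F(u) + G(v) up to a
   constant, absorbed in F, and the rotation acts by
   u |-> P + w (u - P), v |-> Q + w^-1 (v - Q), where w = e^(i phi) and Q is
   the conjugate of P.
   Fix v such that -G(v) is not a critical value of F.  Then F(u) + G(v) has
   only simple roots in u; by invariance of the curve each of them is a root of
   F(P + w (u - P)) + G(v'), v' being the rotated v, and this has the same
   degree, so the two polynomials in u are proportional.  Differentiating in u,
   the Taylor coefficients s_k of g at P satisfy w^(k+1) s_k = c s_k for a
   constant c; the top one gives c = w^n, hence s_(n-2) = 0 because w <> 1, and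
   s_(n-2) = a_(n-2) + (n-1) a_(n-1) P. *)

Require Import Defs.
From mathcomp Require Import separable ring lra.

Set Implicit Arguments.
Unset Strict Implicit.
Unset Printing Implicit Defensive.

Import Order.TTheory GRing.Theory Num.Theory.

Local Open Scope classical_set_scope.
Local Open Scope ring_scope.
Local Open Scope complex_scope.

(** * Angles of cosine one *)

(** Modulo [2 * pi], [phi] becomes [x] in [[0, 2 pi)]; the double-angle formula forces
    [sin (x / 2) = 0], while the sine is positive on [(0, pi)]. *)
Lemma cos_eq1_2pi (R : realType) (phi : R) :
  cos phi = 1 -> exists k : int, phi = k%:~R * (2 * pi).
Proof.
move=> cos1; pose k := Num.floor (phi / (2 * pi)); exists k.
have T_gt0 : 0 < 2 * pi :> R by rewrite mulr_gt0 ?pi_gt0.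
pose x := phi - k%:~R * (2 * pi).
have [x_ge0 x_lt] : 0 <= x /\ x < 2 * pi.
  have /andP[lek ltk] := floor_itv (phi / (2 * pi)).
  move: lek ltk; rewrite -/k ler_pdivlMr // ltr_pdivrMr // intrD mulrDl mul1r.
  by rewrite /x; lra.
have cosx : cos x = 1.
  have Dm m b : cos (b + m%:R * (2 * pi)) = cos b :> R.
    rewrite -(periodicn (@cosD2pi R) m b).
    by rewrite [2 * pi]mulr_natl [m%:R * _]mulr_natl.
  rewrite /x; case: k {x x_ge0 x_lt} => m.
    by rewrite -(Dm m) pmulrn subrK.
  by rewrite NegzE intrN mulNr opprK -pmulrn Dm.
have sinh : sin (x / 2) = 0.
  apply/eqP; move: cosx; rewrite {1}[x]splitr -mulr2n cos_mulr2n cos2sin2.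
  by rewrite -sqrf_eq0 => e; apply/eqP; move: e; lra.
suff : x = 0 by move/eqP; rewrite subr_eq0 => /eqP.
apply/eqP; apply: contraT => x0.
have := @sin_gt0_pi R (x / 2); rewrite sinh ltxx; apply.
by apply/andP; split; [rewrite divr_gt0 // lt_def x0 | rewrite ltr_pdivrMr // mulrC].
Qed.

(** * Evaluation and substitution in two variables *)

Lemma rmorph_mmap (n : nat) (K S T : nzRingType) (u : {rmorphism S -> T})
    (f : {rmorphism K -> S}) (v : 'I_n -> S) (P : {mpoly K[n]}) :
  u (mmap f v P) = mmap (u \o f) (u \o v) P.
Proof.
rewrite /mmap rmorph_sum; apply: eq_bigr => m _.
rewrite rmorphM rmorph_prod; congr (_ * _).
by apply: eq_bigr => i _; rewrite rmorphXn.
Qed.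

Lemma eq_mmap (n : nat) (K S : nzRingType) (f f' : K -> S) (v v' : 'I_n -> S) :
  f =1 f' -> v =1 v' -> mmap f v =1 mmap f' v'.
Proof.
move=> ef ev P; apply: eq_bigr => m _; rewrite ef; congr (_ * _).
by apply: eq_bigr => i _; rewrite ev.
Qed.

Lemma mderiv_map_mpoly (n : nat) (K S : nzRingType) (f : {rmorphism K -> S})
    (i : 'I_n) (P : {mpoly K[n]}) :
  mderiv i (map_mpoly f P) = map_mpoly f (mderiv i P).
Proof.
by apply/mpolyP=> m; rewrite mcoeff_map_mpoly !mcoeff_deriv mcoeff_map_mpoly raddfMn.
Qed.

Lemma tnth2_comp (S T : Type) (u : S -> T) (p q : S) :
  u \o tnth [tuple p; q] =1 tnth [tuple u p; u q].
Proof. by case=> [[|[|i]] lti]. Qed.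

Lemma eval2_map (K S : comNzRingType) (f : {rmorphism K -> S})
    (P : {mpoly K[2]}) (x y : K) :
  eval2 (map_mpoly f P) (f x) (f y) = f (eval2 P x y).
Proof.
rewrite /eval2 /meval rmorph_mmap /map_mpoly rmorph_mmap.
apply: eq_mmap => [c|i] /=; first by rewrite -/(meval _ _) mevalC.
by rewrite -/(meval _ _) mevalXU -[RHS]/((f \o _) i) tnth2_comp.
Qed.

Definition subst2 (K : comNzRingType) (P : {mpoly K[2]}) (p q : {poly K}) :
  {poly K} := mmap polyC (tnth [tuple p; q]) P.

Lemma horner_subst2 (K : comNzRingType) (P : {mpoly K[2]}) (p q : {poly K}) t :
  (subst2 P p q).[t] = eval2 P p.[t] q.[t].
Proof.
rewrite -[LHS]/(horner_eval t _) /subst2 rmorph_mmap.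
apply: eq_mmap => [c|i] /=; first by rewrite /horner_eval hornerC.
exact: (tnth2_comp (horner_eval t)).
Qed.

(** The chain rule is stable under products and linear combinations, so it only has to be checked on
    the variables and on [1]. *)
Lemma deriv_subst2 (K : comNzRingType) (P : {mpoly K[2]}) (p q : {poly K}) :
  (subst2 P p q)^`() = subst2 (dx P) p q * p^`() + subst2 (dy P) p q * q^`().
Proof.
pose rule (P : {mpoly K[2]}) :=
  (subst2 P p q)^`() = subst2 (dx P) p q * p^`() + subst2 (dy P) p q * q^`().
have ruleM P1 P2 : rule P1 -> rule P2 -> rule (P1 * P2).
  rewrite /rule /dx /dy !mderivM /subst2 => h1 h2.
  by rewrite !(rmorphM, rmorphD) /= derivM h1 h2; ring.
have rule1 : rule 1.
  by rewrite /rule /dx /dy /subst2 -mpolyC1 !mderivC !mmap0 mmapC derivC !mul0r addr0.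
have ruleX i : rule 'X_i.
  have submm (j : 'I_2) : (U_(j) - U_(j) = 0)%MM by rewrite -[X in (X - _)%MM]add0m addmK.
  rewrite /rule /dx /dy /subst2 !mderivX !mmapZ !mmapX !mnm1E !mmap1U.
  have [->|->] : i = ord0 \/ i = ord_max.
    by case: i => [[|[|i]] lti] //; [left|right]; apply: val_inj.
  - by rewrite submm mmap11 /= !(mul1r, mul0r, mulr1, polyC1, polyC0, addr0).
  - by rewrite submm mmap11 /= !(mul1r, mul0r, mulr1, polyC1, polyC0, add0r).
have ruleXn i k : rule ('X_i ^+ k).
  by elim: k => [|k IH]; rewrite ?expr0 // exprS; apply: ruleM.
rewrite -/(rule P); elim/mpolyind: P => [|c m P _ _ IH].
  by rewrite /rule /dx /dy /subst2 !mderiv0 !mmap0 deriv0 !mul0r addr0.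
have : rule 'X_[m].
  by rewrite mpolyXE_id; elim/big_ind: _ => // i _; apply: ruleXn.
rewrite /rule /dx /dy !mderivD !mderivZ /subst2 in IH * => hm.
by rewrite !rmorphD /= !mmapZ derivD deriv_mulC hm IH; ring.
Qed.

Lemma eval2_dx_map (K S : comNzRingType) (f : {rmorphism K -> S})
    (P : {mpoly K[2]}) (x y : K) :
  eval2 (dx (map_mpoly f P)) (f x) (f y) = f (eval2 (dx P) x y).
Proof. by rewrite /dx mderiv_map_mpoly eval2_map. Qed.

Lemma eval2_dy_map (K S : comNzRingType) (f : {rmorphism K -> S})
    (P : {mpoly K[2]}) (x y : K) :
  eval2 (dy (map_mpoly f P)) (f x) (f y) = f (eval2 (dy P) x y).
Proof. by rewrite /dy mderiv_map_mpoly eval2_map. Qed.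

(** * Polynomial identities tested on real points *)

Lemma poly_nat_zeros (K : numFieldType) (q : {poly K}) :
  (forall n, q.[n%:R] = 0) -> q = 0.
Proof.
move=> q0; apply/eqP; apply: contraT => qn0.
pose rs : seq K := [seq i%:R | i <- iota 0 (size q)].
have := max_poly_roots (rs := rs) qn0.
rewrite size_map size_iota ltnn; apply.
  by apply/allP => _ /mapP[i _ ->]; apply/rootP.
by rewrite map_inj_uniq ?iota_uniq // => i j /eqP; rewrite eqr_nat => /eqP.
Qed.

Lemma poly_zeros (K : numFieldType) (q : {poly K}) :
  (forall x, q.[x] = 0) -> q = 0.
Proof. by move=> q0; apply: poly_nat_zeros. Qed.

Lemma poly_real_zeros (R : realType) (q : {poly R[i]}) :
  (forall t : R, q.[t%:C] = 0) -> q = 0.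
Proof.
move=> q0; apply: poly_nat_zeros => n.
by rewrite -(rmorph_nat (real_complex R)) q0.
Qed.

(** Two univariate steps: for any complex [y] it suffices to take [x] real, and for such an [x] to
    take [y] real. *)
Lemma real_zeros2 (R : realType) (f : R[i] -> R[i] -> R[i]) :
  (forall y, exists q : {poly R[i]}, forall x, f x y = q.[x]) ->
  (forall x, exists q : {poly R[i]}, forall y, f x y = q.[y]) ->
  (forall x y : R, f x%:C y%:C = 0) -> forall x y, f x y = 0.
Proof.
move=> f1 f2 f0 x y.
have [q eq_q] := f1 y; rewrite eq_q (@poly_real_zeros _ q) ?horner0 // => t.
have [r eq_r] := f2 t%:C; rewrite -eq_q eq_r (@poly_real_zeros _ r) ?horner0 // => s.
by rewrite -eq_r.
Qed.

(** * Primitives and separation of variables *)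

Lemma primitive_poly (K : numFieldType) (q : {poly K}) :
  exists2 Q : {poly K}, Q^`() = q & Q.[0] = 0.
Proof.
(* At index [0] the division by [0] yields [0], hence the zero constant term. *)
exists (\poly_(i < (size q).+1) (q`_i.-1 / i%:R)).
  apply/polyP => i; rewrite coef_deriv coef_poly ltnS /=.
  have [lti|lei] := ltnP; last by rewrite mul0rn nth_default.
  by rewrite -[LHS]mulr_natr divfK // pnatr_eq0.
by rewrite horner_coef0 coef_poly /= invr0 mulr0.
Qed.

Lemma deriv_eq0 (K : numFieldType) (q : {poly K}) (s t : K) :
  q^`() = 0 -> q.[s] = q.[t].
Proof.
move=> q'0; suff -> : q = (q`_0)%:P by rewrite !hornerC.
apply/polyP => -[|i]; rewrite coefC //=; apply/eqP.
have /eqP := congr1 (fun r : {poly K} => r`_i) q'0.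
by rewrite coef_deriv coef0 mulrn_eq0.
Qed.

Lemma real_identity2 (R : realType) (P Q : {mpoly R[i][2]}) (q : {poly R[i]})
    (c : R[i]) :
  (forall x y : R, eval2 P x%:C y%:C + c * eval2 Q x%:C y%:C
                   = q.[x%:C - c * y%:C]) ->
  forall x y : R[i], eval2 P x y + c * eval2 Q x y = q.[x - c * y].
Proof.
move=> eqR x y; apply/eqP; rewrite -subr_eq0; apply/eqP.
move: x y; apply: real_zeros2 => [y|x|x y].
- exists (subst2 P 'X y%:P + c%:P * subst2 Q 'X y%:P
           - (q \Po ('X - (c * y)%:P))) => x.
  by rewrite !(hornerE, horner_subst2, horner_comp).
- exists (subst2 P x%:P 'X + c%:P * subst2 Q x%:P 'X
           - (q \Po (x%:P - c%:P * 'X))) => y.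
  by rewrite !(hornerE, horner_subst2, horner_comp).
- by rewrite eqR subrr.
Qed.

(** Since [c * c = -1], the sum and difference of the two first-order identities show that both
    sides have the same gradient; they agree at the origin. *)
Lemma eval2_separated (K : numFieldType) (P : {mpoly K[2]})
    (c : K) (F G : {poly K}) :
  c * c = -1 -> F.[0] = 0 -> G.[0] = 0 ->
  (forall x y, eval2 (dx P) x y - c * eval2 (dy P) x y = F^`().[x + c * y]) ->
  (forall x y, eval2 (dx P) x y + c * eval2 (dy P) x y = G^`().[x - c * y]) ->
  forall x y, 2 * eval2 P x y = 2 * eval2 P 0 0 + F.[x + c * y] + G.[x - c * y].
Proof.
move=> c2 F0 G0 dF dG x y.
pose u := x + c * y; pose v := x - c * y.
(* Integrate along the segment from (0, 0) to (x, y). *)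
pose q := 2%:P * subst2 P (x%:P * 'X) (y%:P * 'X)
  - (F \Po (u%:P * 'X)) - (G \Po (v%:P * 'X)).
have q'0 : q^`() = 0.
  have -> : q^`() = 2%:P * (subst2 (dx P) (x%:P * 'X) (y%:P * 'X) * x%:P
      + subst2 (dy P) (x%:P * 'X) (y%:P * 'X) * y%:P)
      - (F^`() \Po (u%:P * 'X)) * u%:P - (G^`() \Po (v%:P * 'X)) * v%:P.
    by rewrite /q !derivB deriv_mulC deriv_subst2 !deriv_comp !deriv_mulC !derivX !mulr1.
  apply: poly_zeros => t.
  rewrite !(hornerE, horner_subst2, horner_comp).
  have := dF (x * t) (y * t); have := dG (x * t) (y * t).
  rewrite !mulrA -mulrDl -mulrBl -/u -/v => <- <-.
  rewrite /u /v; set X := eval2 _ _ _; set Y := eval2 _ _ _.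
  transitivity (2 * Y * y * (1 + c * c)); first by ring.
  by rewrite c2 subrr mulr0.
have := deriv_eq0 1 0 q'0; rewrite /q.
rewrite !(hornerE, horner_subst2, horner_comp) F0 G0 => /eqP.
rewrite !subr0 !subr_eq => /eqP ->; rewrite -/u -/v; ring.
Qed.

(** * Taylor coefficients under shift and scaling *)

Lemma coef_comp_XaddC (K : comNzRingType) (q : {poly K}) (x : K) (i : nat) :
  (q \Po ('X + x%:P))`_i = q^`N(i).[x].
Proof.
elim/poly_ind: q i => [|q c IH] i.
  by rewrite comp_poly0 coef0 raddf0 horner0.
rewrite comp_polyD comp_polyM comp_polyX comp_polyC mulrDr coefD coefD coefMX coefMC coefC.
case: i => [|i] /=; first by rewrite IH !nderivn0 add0r !hornerE.
by rewrite !IH nderivnMXaddC !hornerE.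
Qed.

Lemma coef_comp_ZX (K : comNzRingType) (q : {poly K}) (c : K) (i : nat) :
  (q \Po (c *: 'X))`_i = c ^+ i * q`_i.
Proof.
elim/poly_ind: q i => [|q d IH] i; first by rewrite comp_poly0 !coef0 mulr0.
rewrite comp_polyD comp_polyM comp_polyX comp_polyC -scalerAr !coefD coefZ !coefMX !coefC.
case: i => [|i] /=; first by rewrite mulr0 !add0r mul1r.
by rewrite !addr0 IH exprS mulrA.
Qed.

(** The [n]-th Hasse derivative of [q] has degree at most one, so only the top two coefficients
    enter. *)
Lemma subleading_coef_comp_XaddC (K : comNzRingType) (q : {poly K}) (x : K) (n : nat) :
  size q = n.+2 ->
  (q \Po ('X + x%:P))`_n = q`_n + n.+1%:R * q`_n.+1 * x.
Proof.
move=> szq; rewrite coef_comp_XaddC (@horner_coef_wide _ 2).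
  rewrite big_ord_recl big_ord1 /= !coef_nderivn addn0 addn1 binn mulr1n expr0 mulr1.
  by rewrite expr1 binSn mulr_natl.
apply/leq_sizeP => j le2j; rewrite coef_nderivn nth_default ?mul0rn //.
by rewrite szq -addn2 leq_add2l.
Qed.

(** * Comparison of a fiber with its rotated copy *)

(** Up to a scalar, [p] is a product of distinct linear factors. *)
Lemma dvdp_separable_roots (K : closedFieldType) (p q : {poly K}) :
  coprimep p p^`() -> (forall x, root p x -> root q x) -> p %| q.
Proof.
move=> cop pq; have [rs def_p] := closed_field_poly_normal p.
have p0 : lead_coef p != 0.
  rewrite lead_coef_eq0; apply/negP => /eqP p0.
  by move: cop; rewrite p0 deriv0 coprimep0 -size_poly_eq1 size_poly0.
have eq_p : p %= \prod_(z <- rs) ('X - z%:P) by rewrite {1}def_p eqp_scale.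
have : separable_poly p by rewrite unlock.
rewrite (eqp_separable eq_p) separable_prod_XsubC => uniq_rs.
rewrite (eqp_dvdl _ eq_p) uniq_roots_dvdp // ?uniq_rootsE //.
by apply/allP => x rs_x; apply: pq; rewrite (eqp_root eq_p) root_prod_XsubC.
Qed.

(* [x + w (u - x)] is the rotated [u] and [f v] the rotated [v]; nothing needs to
   be known about [f], since [v] is fixed throughout. *)
Lemma rotated_fiber_coef (K : numClosedFieldType) (F G : {poly K}) (w x : K)
    (k : nat) (f : K -> K) :
  size F^`() = k.+2 -> (1 < size G)%N -> w != 0 -> w != 1 ->
  (forall u v, F.[u] + G.[v] = 0 -> F.[x + w * (u - x)] + G.[f v] = 0) ->
  (F^`() \Po ('X + x%:P))`_k = 0.
Proof.
move=> szg szG w0 w1 invFG; set g := F^`() in szg *; set s := g \Po _.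
have [rs def_g] := closed_field_poly_normal g.
have g0 : g != 0 by rewrite -size_poly_eq0 szg.
pose T := \prod_(r <- rs) (G + F.[r]%:P).
apply/eqP; apply: contraT => sk0.
(* A [v] with [T.[v] != 0] is one for which [- G.[v]] is not a critical value
   of [F]. *)
have : T != 0.
  rewrite prodf_seq_neq0; apply/allP => r _; apply/implyP => _.
  rewrite -size_poly_eq0 size_polyDl -?lt0n ?(ltnW szG) //.
  exact: leq_ltn_trans (size_polyC_leq1 _) szG.
apply: contraNT => _; apply/eqP/poly_zeros => v; apply/eqP; apply: contraT => Tv0.
pose A := F + (G.[v])%:P; pose L := x%:P + w *: ('X - x%:P).
pose B := (F \Po L) + (G.[f v])%:P.
have A' : A^`() = g by rewrite /A derivD derivC addr0.
(* A common root [y] would be a critical point with [F.[y] = - G.[v]], so a factor of [T] would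
   vanish at [v]. *)
have copA : coprimep A A^`().
  rewrite A'; apply: Pdiv.ClosedField.root_coprimep => y /rootP.
  rewrite /A hornerD hornerC => Ay; apply: contraNneq Tv0 => gy.
  rewrite /T horner_prod prodf_seq_eq0; apply/hasP; exists y => /=.
    rewrite -root_prod_XsubC; have /rootP := gy.
    by rewrite {1}def_g rootZ // lead_coef_eq0.
  by rewrite hornerD hornerC addrC Ay.
have AB : A %| B.
  apply: dvdp_separable_roots copA _ => y /rootP.
  rewrite /A hornerD hornerC => Ay; apply/rootP.
  by rewrite /B /L !(hornerE, horner_comp); apply: invFG.
have szL : size L = 2%N.
  rewrite /L addrC size_polyDl size_scale // size_XsubC // size_polyC.
  by case: (x != 0).
have szF : (1 < size F)%N.
  rewrite ltnNge; apply/negP => /size1_polyC F1.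
  by move: g0; rewrite /g F1 derivC eqxx.
have szAB : size A = size B.
  have szc c : (size (c%:P : {poly K}) < size F)%N.
    exact: leq_ltn_trans (size_polyC_leq1 _) szF.
  by rewrite /A /B !size_polyDl ?size_comp_poly2.
have [c _ eqBA] : exists2 c, c != 0 & B = c *: A.
  apply: eqpf_eq; rewrite eqp_sym -dvdp_size_eqp //; exact/eqP.
(* Differentiate [B = c *: A] and recentre at [x]: there [L] becomes scaling by [w], which gives
   [w ^+ i], and its derivative gives one more [w]. *)
have eq_coef i : w ^+ i.+1 * s`_i = c * s`_i.
  have eqL : L \Po ('X + x%:P) = ('X + x%:P) \Po (w *: 'X).
    by rewrite /L -polyCN !(comp_polyD, comp_polyZ, comp_polyC, comp_polyX) polyCN addrK addrC.
  have := congr1 (fun q => (q^`() \Po ('X + x%:P))`_i) eqBA.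
  rewrite /B derivD derivC addr0 deriv_comp derivZ A' -/g.
  have -> : L^`() = w%:P.
    by rewrite /L derivD derivC add0r derivZ derivXsubC -mul_polyC mulr1.
  rewrite comp_polyM comp_polyC coefMC -comp_polyA eqL comp_polyA coef_comp_ZX.
  by rewrite comp_polyZ coefZ mulrAC -exprSr.
have sk1 : s`_k.+1 != 0.
  have szs : size s = k.+2 by rewrite /s size_comp_poly2 ?szg // size_XaddC.
  by rewrite -[k.+1]/(k.+2.-1) -szs -lead_coefE lead_coef_eq0 -size_poly_eq0 szs.
(* The top coefficient determines [c]; a nonzero [s_k] would then force [w = 1]. *)
have c_w : c = w ^+ k.+2 by apply: (mulIf sk1); rewrite eq_coef.
have := eq_coef k; rewrite c_w => /(mulIf sk0)/eqP.
by rewrite [w ^+ k.+2]exprS -{1}[w ^+ k.+1]mul1r (inj_eq (mulIf _)) ?expf_neq0 // eq_sym (negPf w1).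
Qed.

(** * The associated polynomial at complex points *)

Lemma associated_dx_dy (R : realType) (h : {mpoly R[2]}) (g : {poly R[i]}) :
  associated h g -> forall x y : R[i],
  eval2 (dx (map_mpoly (real_complex R) h)) x y
    - 'i%C * eval2 (dy (map_mpoly (real_complex R) h)) x y = g.[x + 'i%C * y].
Proof.
(* The signs are rearranged to apply [real_identity2] with [c = - 'i]. *)
move=> g_h x y; rewrite -[in RHS](opprK 'i%C) -mulNr [in RHS]mulNr.
apply: real_identity2 => {}x {}y; rewrite eval2_dx_map eval2_dy_map !mulNr opprK.
have -> : x%:C + 'i%C * y%:C = x +i* y by rewrite [RHS]complexE.
by rewrite g_h [RHS]complexE /= raddfN mulrN.
Qed.

(** At real points this is the conjugate of the identity defining [g], because the partial
    derivatives of [h] are real there. *)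
Lemma associated_conj_dx_dy (R : realType) (h : {mpoly R[2]}) (g : {poly R[i]}) :
  associated h g -> forall x y : R[i],
  eval2 (dx (map_mpoly (real_complex R) h)) x y
    + 'i%C * eval2 (dy (map_mpoly (real_complex R) h)) x y
  = (map_poly (@conjc R) g).[x - 'i%C * y].
Proof.
move=> g_h; apply: real_identity2 => x y.
rewrite eval2_dx_map eval2_dy_map.
have -> : x%:C - 'i%C * y%:C = conjc (x +i* y).
  by rewrite [RHS]complexE /= raddfN mulrN.
by rewrite horner_map g_h [RHS]complexE /= opprK.
Qed.

(** * The center of the rotation *)

Theorem theorem16 (R : realType) (n : nat) (h : {mpoly R[2]})
    (g : {poly R[i]}) (a : nat -> R[i]) (p : R * R) (phi : R)
    (n_gt1 : (1 < n)%N)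
    (h_harmonic : harmonic h)
    (h_degree : msize h = n.+1)
    (g_associated : associated h g)
    (g_coefs : g = \poly_(j < n) a j)
    (a_lead : a n.-1 != 0)
    (phi_nontrivial : forall k : int, phi <> k%:~R * (2 * pi))
    (h_invariant : invariant_under (rotation p phi) (curve h)) :
  p.1 +i* p.2 = - (a n.-2 / ((n.-1)%:R * a n.-1)).
Proof.
case: n n_gt1 {h_degree} g_coefs a_lead => [|[|k]] //= _ g_coefs a_lead.
have sz_g : size g = k.+2 by rewrite g_coefs size_poly_eq.
pose ii : R[i] := 'i%C.
have ii2 : ii * ii = -1 by rewrite -expr2 sqr_i.
have i0 : ii != 0.
  by apply: contra_eq_neq ii2 => ->; rewrite mul0r eq_sym oppr_eq0 oner_eq0.
have [F1 dF1 F10] := primitive_poly g.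
have [G dG G0] := primitive_poly (map_poly (@conjc R) g).
set hC := map_mpoly (real_complex R) h.
pose F := F1 + (2 * eval2 hC 0 0)%:P.
have dF : F^`() = g by rewrite derivD derivC addr0.
have curveE x y : curve h (x, y) <-> F.[x + ii * y] + G.[x - ii * y] = 0.
  have := @eval2_separated _ hC ii F1 G ii2 F10 G0 _ _ x y.
  rewrite dF1 dG => /(_ (associated_dx_dy g_associated)).
  move=> /(_ (associated_conj_dx_dy g_associated)) hF.
  rewrite /F hornerD hornerC [F1.[_] + _]addrC -hF /curve /= -/hC.
  split=> [->|/eqP]; first by rewrite mulr0.
  by rewrite mulf_eq0 pnatr_eq0 /= => /eqP.
(* Isotropic coordinates of the center, followed by the multipliers [e^(i phi)] and [e^(-i phi)]. *)
pose P := p.1%:C + ii * p.2%:C; pose Q := p.1%:C - ii * p.2%:C.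
pose w := (cos phi)%:C + ii * (sin phi)%:C.
pose w' := (cos phi)%:C - ii * (sin phi)%:C.
have ww' : w * w' = 1.
  transitivity ((cos phi)%:C ^+ 2 - ii * ii * (sin phi)%:C ^+ 2).
    by rewrite /w /w'; ring.
  by rewrite ii2 mulN1r opprK -!rmorphXn -rmorphD cos2Dsin2.
have w0 : w != 0.
  by apply: contra_eq_neq ww' => ->; rewrite mul0r eq_sym oner_eq0.
have w1 : w != 1.
  apply/eqP => w1; have [|m] := @cos_eq1_2pi R phi; last exact: phi_nontrivial.
  by have := congr1 (@complex.Re R) w1; rewrite /w /ii /= !mul0r !mulr0 subr0 addr0.
have invFG u v : F.[u] + G.[v] = 0 ->
    F.[P + w * (u - P)] + G.[Q + w' * (v - Q)] = 0.
  (* The point with isotropic coordinates [u] and [v]. *)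
  pose x := (u + v) / 2; pose y := (u - v) / (2 * ii).
  have ux : u = x + ii * y by rewrite /x /y; field.
  have vx : v = x - ii * y by rewrite /x /y; field.
  rewrite {1}ux {1}vx => /curveE hxy.
  have : curve h (rotation p phi (x, y)).
    by rewrite -h_invariant; exists (x, y).
  move/curveE; rewrite ux vx /=.
  set c := (cos phi)%:C; set s := (sin phi)%:C.
  congr (F.[_] + G.[_] = 0); rewrite /P /Q /w /w' -/c -/s.
    set X := _ - p.1%:C; set Y := y - _.
    transitivity (p.1%:C + ii * p.2%:C + c * X - s * Y + ii * (s * X + c * Y)).
      ring.
    (* Replacing [-1] by [ii * ii] leaves a pure ring identity. *)
    transitivity (p.1%:C + ii * p.2%:C + c * X + ii * ii * (s * Y)
       + ii * (s * X + c * Y)); first by rewrite ii2; ring.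
    by rewrite /X /Y; ring.
  set X := _ - p.1%:C; set Y := y - _.
  transitivity (p.1%:C - ii * p.2%:C + c * X - s * Y - ii * (s * X + c * Y)).
    ring.
  transitivity (p.1%:C - ii * p.2%:C + c * X + ii * ii * (s * Y)
     - ii * (s * X + c * Y)); first by rewrite ii2; ring.
  by rewrite /X /Y; ring.
have sz_G : (1 < size G)%N.
  rewrite ltnNge; apply/negP => /size1_polyC G1.
  have := size_map_poly (@conjc R) g.
  by rewrite -dG G1 derivC size_poly0 sz_g.
have := @rotated_fiber_coef _ F G w P k (fun v => Q + w' * (v - Q)).
rewrite dF => /(_ sz_g sz_G w0 w1 invFG).
rewrite (subleading_coef_comp_XaddC _ sz_g) g_coefs !coef_poly leqnn ltnW //.
have -> : p.1 +i* p.2 = P by rewrite [LHS]complexE.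
have n0 : k.+1%:R != 0 :> R[i] by rewrite pnatr_eq0.
(* The vanishing coefficient reads [a k + k.+1%:R * a k.+1 * P = 0], to be solved for [P]. *)
move=> /eqP; rewrite addrC addr_eq0 => /eqP e.
apply: (mulfI (mulf_neq0 n0 a_lead)); rewrite e.
by rewrite mulrN mulrCA divff ?mulr1 // mulf_neq0.
Qed.
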